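(* For any real $\alpha\neq 0$ and any real $b>a\geq 1$, the set $\Theta_{\infty}(\alpha)\cap(a,b)$ has the same cardinality as $\mathbb{R}$. In particular $\Theta_{\infty}(\alpha)$ is dense in $(1,\infty)$.
   Context: For real $x$, $\Vert x\Vert$ denotes the distance from $x$ to the nearest integer. For real $\alpha\neq 0$ and $\zeta>1$, $$\overline{\sigma}(\alpha,\zeta):=\limsup_{n\to\infty}-\frac{\log\Vert\alpha\zeta^{n}\Vert}{n\log\zeta},$$ where $n$ runs through the positive integers and the quotient is read as $+\infty$ when $\Vert\alpha\zeta^n\Vert=0$. For real $\alpha\neq 0$, $\Theta_\infty(\alpha)$ denotes the set of real $\zeta>1$ such that $\overline{\sigma}(\alpha,\zeta)=\infty$. *)

(* Defs.v *)
From HB Require Import structures.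
From mathcomp Require Import all_boot all_order all_algebra.
From mathcomp Require Import all_classical all_reals all_analysis.

Set Implicit Arguments.
Unset Strict Implicit.
Unset Printing Implicit Defensive.

Import Order.TTheory GRing.Theory Num.Theory numFieldNormedType.Exports.

Local Open Scope classical_set_scope.
Local Open Scope ring_scope.

Definition dist_nearest_int (R : realType) (x : R) : R :=
  inf [set `|x - m%:~R| | m in [set: int]].

(* The zero case is explicit because the library sets ln 0 = 0. *)
Definition approx_quotient (R : realType) (alpha zeta : R) (n : nat) : \bar R :=
  let d := dist_nearest_int (alpha * zeta ^+ n) in
  if d == 0 then +oo%E else (- ln d / (n%:R * ln zeta))%:E.

(* The shift n.+1 makes the exponent run through the positive integers. *)
Definition sigma_bar (R : realType) (alpha zeta : R) : \bar R :=
  limn_esup (fun n => approx_quotient alpha zeta n.+1).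

Definition Theta_infty (R : realType) (alpha : R) : set R :=
  [set zeta | 1 < zeta /\ sigma_bar alpha zeta = +oo%E].

(* Main.v *)
Require Import Defs.
From mathcomp Require Import all_boot all_order all_algebra.
From mathcomp Require Import all_classical all_reals all_analysis.
From mathcomp Require Import lra.

Import Order.TTheory GRing.Theory Num.Theory numFieldNormedType.Exports.

Local Open Scope classical_set_scope.
Local Open Scope card_scope.
Local Open Scope ring_scope.

(** Let [good_approx alpha k] be the set of the [x] for which some exponent
    [n > k] gives a quotient at least [k].  Every [x > 1] lying in all of these
    sets has infinite upper exponent, so it suffices to find as many points as
    there are reals in their intersection within [(a, b)].

    For fixed [k] the set [good_approx alpha k] contains a nondegenerate interval
    inside each nondegenerate [[u, v]] with [u >= 1] ([thick_good_approx]).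
    Indeed [v ^ n - u ^ n] tends to infinity, so for large [n] the values
    [alpha * x ^ n] sweep an interval of length greater than one and hit an
    integer at an interior point [x0].  Near [x0] the distance of
    [alpha * x ^ n] to that integer is as small as desired, in particular less
    than [v ^ (- k * n)], hence than [x ^ (- k * n)], which is what a quotient at
    least [k] means.

    Countably many sets with this property have an intersection that contains a
    Cantor set ([injfun_thick_bigcap]): keep the left or the right third of the
    current interval according to the next bit, then shrink it into the next set.
    Distinct bit sequences end in disjoint intervals.  Since a real is determined
    by the rationals below it, [R] injects into the set of bit sequences, and the
    Cantor-Bernstein theorem concludes.  Density holds because every interval to
    the right of a point [x > 1] meets the set. *)

(** * Cantor schemes on the real line *)

(** The interior of [G] is dense in [[a, b]]; closed intervals are used so that
    nested sequences of them have a common point. *)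
Definition thick_in {R : realType} (a b : R) (G : set R) : Prop :=
  forall u v, a <= u -> u < v -> v <= b ->
    exists u' v', [/\ u <= u', u' < v', v' <= v & `[u', v'] `<=` G].

Definition outer_third {R : realType} (c : bool) (I : R * R) : R * R :=
  if c then (I.2 - (I.2 - I.1) / 3, I.2) else (I.1, I.1 + (I.2 - I.1) / 3).

(** The nested intervals attached to a bit sequence: bit [j] chooses a third of
    the [j]-th cell, which [shrink j] then moves into the [j]-th set. *)
Fixpoint cell {R : realType} (shrink : nat -> R * R -> R * R) (I0 : R * R)
    (s : nat -> bool) (k : nat) : R * R :=
  if k is j.+1 then
    shrink j (outer_third (s j) (cell shrink I0 s j))
  else I0.

Lemma eq_cell {R : realType} (shrink : nat -> R * R -> R * R) (I0 : R * R)
    (s t : nat -> bool) (k : nat) :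
  (forall j, (j < k)%N -> s j = t j) ->
  cell shrink I0 s k = cell shrink I0 t k.
Proof.
elim: k => //= k IH st; rewrite st// IH// => j jk.
by apply: st; rewrite ltnS ltnW.
Qed.

(** A quantitative form of the Baire category theorem: such an intersection is
    not only nonempty but has at least the cardinality of the continuum.  The
    injection sends a bit sequence to the supremum of the left ends of its cells;
    at the first bit where two sequences differ, their cells are placed in the
    two outer thirds of a common cell, hence their points differ. *)
Lemma injfun_thick_bigcap {R : realType} (a b : R) (G : nat -> set R) :
  a < b -> (forall k, thick_in a b (G k)) ->
  [set: nat -> bool] #<= `]a, b[ `&` \bigcap_k G k.
Proof.
move=> ab thickG.
have [shrink shrinkP] : exists f : nat -> R * R -> R * R, forall k I,
    a <= I.1 -> I.1 < I.2 -> I.2 <= b ->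
    [/\ I.1 <= (f k I).1, (f k I).1 < (f k I).2, (f k I).2 <= I.2 &
        `[(f k I).1, (f k I).2] `<=` G k].
  (* [choice] takes a single argument, so the index and the interval are paired;
     a pair that does not satisfy the hypotheses is sent to itself. *)
  have [f fP] : {f : nat * (R * R) -> R * R & forall p,
      a <= p.2.1 -> p.2.1 < p.2.2 -> p.2.2 <= b ->
      [/\ p.2.1 <= (f p).1, (f p).1 < (f p).2, (f p).2 <= p.2.2 &
          `[(f p).1, (f p).2] `<=` G p.1]}.
    apply: (@choice _ _ (fun p I => a <= p.2.1 -> p.2.1 < p.2.2 -> p.2.2 <= b ->
      [/\ p.2.1 <= I.1, I.1 < I.2, I.2 <= p.2.2 & `[I.1, I.2] `<=` G p.1])).
    move=> -[k [u v]] /=.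
    have [[au [uv vb]]|nuv] := pselect (a <= u /\ u < v /\ v <= b).
      by have [u' [v' ?]] := thickG k _ _ au uv vb; exists (u', v').
    by exists (u, v) => au uv vb; exfalso; apply: nuv.
  by exists (fun k I => f (k, I)) => k I; exact: fP (k, I).
(* The starting cell avoids [a] and [b], so the limit points lie in the open
   interval. *)
pose I0 : R * R := (a + (b - a) / 3, b - (b - a) / 3).
pose C := cell shrink I0.
have CP s k : [/\ I0.1 <= (C s k).1, (C s k).1 < (C s k).2 & (C s k).2 <= I0.2].
  elim: k => [|k [IH1 IH2 IH3]]; first by split=> //=; lra.
  rewrite /C /= -/(C s k).
  set J := outer_third _ _.
  have [J1 J2 J3] : [/\ (C s k).1 <= J.1, J.1 < J.2 & J.2 <= (C s k).2].
    by rewrite /J /outer_third; case: ifP => _ /=; split; lra.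
  rewrite /I0 /= in IH1 IH2 IH3 *.
  have [] := shrinkP k J; [lra|exact: J2|lra|].
  by move=> H1 H2 H3 _; split; lra.
have thirdP s k : [/\ (C s k).1 <= (outer_third (s k) (C s k)).1,
    (outer_third (s k) (C s k)).1 < (outer_third (s k) (C s k)).2 &
    (outer_third (s k) (C s k)).2 <= (C s k).2].
  have [_ H _] := CP s k.
  by rewrite /outer_third; case: ifP => _ /=; split; lra.
have CS s k : [/\ (outer_third (s k) (C s k)).1 <= (C s k.+1).1,
    (C s k.+1).2 <= (outer_third (s k) (C s k)).2 &
    `[(C s k.+1).1, (C s k.+1).2] `<=` G k].
  have [J1 J2 J3] := thirdP s k; have [H1 H2 H3] := CP s k.
  rewrite /I0 /= in H1 H3.
  by have [] := shrinkP k _ (le_trans _ J1) J2 (le_trans J3 _); [lra|lra|].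
have Cmono s j k : (j <= k)%N ->
    (C s j).1 <= (C s k).1 /\ (C s k).2 <= (C s j).2.
  elim: k => [|k IH]; first by rewrite leqn0 => /eqP->.
  rewrite leq_eqVlt => /predU1P[->//|]; rewrite ltnS => /IH[H1 H2].
  by have [? _ ?] := thirdP s k; have [? ? _] := CS s k; split; lra.
pose pt s := sup (range (fun k => (C s k).1)).
have ptC s k : pt s \in `[(C s k).1, (C s k).2].
  rewrite in_itv/=; apply/andP; split.
    apply: ub_le_sup; last by exists k.
    exists I0.2 => _ [j _ <-].
    by have [_ H1 H2] := CP s j; apply: le_trans (ltW H1) H2.
  apply: ge_sup; first by exists (C s 0%N).1, 0%N.
  move=> _ [j _ <-].
  have [_ H _] := CP s (maxn j k).
  have [H1 _] := Cmono s _ _ (leq_maxl j k).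
  by have [_ H2] := Cmono s _ _ (leq_maxr j k); lra.
apply/pcard_leP/injfunPex; exists pt.
  move=> s _; split; last by move=> k _; have [_ _] := CS s k; apply; exact: ptC.
  have := ptC s 0%N; rewrite /C /= !in_itv/= => /andP[H1 H2].
  by apply/andP; split; lra.
move=> s t _ _ st; apply/funext => k.
elim/ltn_ind: k => k IH; apply/eqP/negPn/negP => stk.
have Est : C s k = C t k by exact: eq_cell.
have := ptC s k.+1; have := ptC t k.+1; rewrite -st !in_itv/=.
have [+ + _] := CS s k; have [+ + _] := CS t k.
have [_ + _] := CP t k; rewrite Est /outer_third.
by case: (s k) (t k) stk => -[]//= _; lra.
Qed.

(** Dedekind cuts, encoded through an enumeration of the rationals. *)
Lemma card_le_real_bool_seq (R : realType) : [set: R] #<= [set: nat -> bool].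
Proof.
pose cut (x : R) (n : nat) : bool :=
  if unpickle n is Some q then ratr (q : rat) < x else false.
apply/pcard_leP/injfunPex; exists cut => // x y _ _ cutxy.
wlog xy : x y cutxy / x < y.
  move=> H; case: (ltgtP x y) => // [xy|yx]; first exact: H.
  by apply/esym/H.
have [q /[!in_itv]/= /andP[xq qy]] := rat_in_itvoo xy.
have := congr1 (fun f => f (pickle q)) cutxy.
by rewrite /cut pickleK qy ltNge (ltW xq).
Qed.

(** * Good approximation by integers *)

Lemma dist_nearest_int_ge0 {R : realType} (x : R) : 0 <= dist_nearest_int x.
Proof.
by apply: lb_le_inf; [exists `|x - 0%:~R|, 0|move=> _ [m _ <-]].
Qed.

Lemma dist_nearest_int_le {R : realType} (x : R) (m : int) :
  dist_nearest_int x <= `|x - m%:~R|.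
Proof. by apply: ge_inf; [exists 0 => _ [? _ <-]|exists m]. Qed.

(** The bound [k] serves both for the exponent and for the quotient, so that
    membership for all [k] forces large quotients at arbitrarily large
    exponents. *)
Definition good_approx {R : realType} (alpha : R) (k : nat) : set R :=
  [set x | exists2 n, (k <= n)%N & (k%:R%:E <= approx_quotient alpha x n.+1)%E].

Lemma approx_quotient_ge {R : realType} (alpha x : R) (k n : nat) : 1 < x ->
  dist_nearest_int (alpha * x ^+ n.+1) <= (x ^+ (k * n.+1))^-1 ->
  (k%:R%:E <= approx_quotient alpha x n.+1)%E.
Proof.
move=> x1 dx; rewrite /approx_quotient; case: ifPn => [_|dN0]; first exact: leey.
have lnx : 0 < ln x by exact: ln_gt0.
have x0 : 0 < x by lra.
have d0 : 0 < dist_nearest_int (alpha * x ^+ n.+1).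
  by rewrite lt_neqAle eq_sym dN0 dist_nearest_int_ge0.
rewrite lee_fin ler_pdivlMr ?mulr_gt0 ?ltr0n// lerNr.
have -> : - (k%:R * (n.+1%:R * ln x)) = ln (x ^+ (k * n.+1))^-1.
  by rewrite lnV ?posrE ?exprn_gt0// lnXn// -[in RHS]mulr_natl natrM mulrA.
by rewrite ler_ln ?posrE ?invr_gt0 ?exprn_gt0.
Qed.

Lemma sigma_bar_pinfty {R : realType} (alpha x : R) :
  (forall k, good_approx alpha k x) -> sigma_bar alpha x = +oo%E.
Proof.
move=> levelx; apply/ereal_inf_pinfty => _ [V [N _ NV] <-].
apply/eqyP => A A0.
have [n kn Hn] := levelx (maxn N (Num.truncn A).+1).
apply: le_ereal_sup_tmp; exists (approx_quotient alpha x n.+1).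
  by exists n => //; apply: NV => /=; exact: leq_trans (leq_maxl _ _) kn.
apply: le_trans Hn; rewrite lee_fin (le_trans (ltW (truncnS_gt A)))//.
by rewrite ler_nat leq_maxr.
Qed.

(** The ends [p] and [q] are not ordered because the lemma is applied to the
    values of [x |-> alpha * x ^ n], which is decreasing for negative [alpha]. *)
Lemma int_strictly_between {R : realType} (p q : R) : 1 < `|q - p| ->
  exists m : int, Num.min p q < m%:~R < Num.max p q.
Proof.
move=> pq; exists (Num.floor (Num.min p q) + 1).
rewrite floorD1_gt/= intrD.
have := floor_le_tmp (Num.min p q).
by move: pq; case: (leP p q) => H; [rewrite ger0_norm|rewrite ltr0_norm]; lra.
Qed.

Lemma exprn_gap_ge {R : realType} (u v : R) (n : nat) : 1 <= u -> u <= v ->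
  (v - u) * n%:R <= v ^+ n - u ^+ n.
Proof.
move=> u1 uv; elim: n => [|n IH]; first by rewrite !expr0; lra.
have un : 1 <= u ^+ n by exact: exprn_ege1.
have uvn : 0 <= (v - u) * n%:R by rewrite mulr_ge0// subr_ge0.
have H1 : 0 <= (v - 1) * (v ^+ n - u ^+ n) by rewrite mulr_ge0//; lra.
have H2 : 0 <= (v - u) * (u ^+ n - 1) by rewrite mulr_ge0//; lra.
rewrite !exprS -natr1; lra.
Qed.

(** For [n] large the values of [alpha * x ^ n] on [[u, v]] sweep more than a unit
    length, so they reach an integer in the interior; continuity then gives an
    interval of good approximations. *)
Lemma thick_good_approx {R : realType} (alpha a b : R) (k : nat) :
  alpha != 0 -> 1 <= a -> thick_in a b (good_approx alpha k).
Proof.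
move=> alpha0 a1 u v au uv vb.
have al : 0 < `|alpha| by rewrite normr_gt0.
have c0 : 0 < `|alpha| * (v - u) by rewrite mulr_gt0// subr_gt0.
pose n := maxn k (Num.truncn (`|alpha| * (v - u))^-1).
pose f x : R := alpha * x ^+ n.+1.
(* By [exprn_gap_ge], [n.+1] exceeding the inverse of [|alpha| (v - u)] makes
   the image of [[u, v]] longer than one. *)
have gap : 1 < `|f v - f u|.
  rewrite /f -mulrBr normrM.
  have := exprn_gap_ge u v n.+1 (le_trans a1 au) (ltW uv).
  move=> /(ler_wpM2l (ltW al)) gapn.
  rewrite [`|_ - _|]ger0_norm ?subr_ge0 ?lerXn2r ?nnegrE; [|lra..].
  apply: lt_le_trans gapn.
  rewrite mulrA -ltr_pdivrMl// mulr1 (lt_le_trans (truncnS_gt _))//.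
  by rewrite ler_nat ltnS leq_maxr.
have [m /andP[m1 m2]] := int_strictly_between _ _ gap.
have fcont : continuous f.
  by move=> x; apply: cvgM; [exact: cvg_cst|exact: exprn_continuous].
have [x0 /[!in_itv]/= /andP[ux0 x0v] fx0] :
    exists2 c, c \in `[u, v] & f c = m%:~R.
  apply: IVT; first exact: ltW.
    exact: continuous_subspaceT.
  by rewrite !ltW.
have x0u : u < x0.
  rewrite lt_neqAle ux0 andbT; apply/eqP => ux.
  by move: m1 m2; rewrite -fx0 -ux; case: (leP (f u) (f v)); lra.
have x0v' : x0 < v.
  rewrite lt_neqAle x0v andbT; apply/eqP => ux.
  by move: m1 m2; rewrite -fx0 -ux; case: (leP (f u) (f x0)); lra.
have v0 : 0 < v by lra.
(* A tolerance that does not depend on [x]: it is below [x ^ (- k * n.+1)] for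
   every [x <= v]. *)
pose e := (v ^+ (k * n.+1))^-1.
have e0 : 0 < e by rewrite invr_gt0 exprn_gt0.
have : \forall x \near x0, u < x /\ x < v /\ `|f x - m%:~R| < e.
  near=> x; split; [|split].
  - near: x; exact: lt_nbhsr.
  - near: x; exact: lt_nbhsl.
  - rewrite -fx0 distrC; near: x.
    by have /cvgrPdist_lt := fcont x0; apply.
case/nbhs_ballP => r /= r0 near_x0.
(* Halving the radius makes the closed interval fit in the open ball. *)
exists (x0 - r / 2), (x0 + r / 2).
have ball_x0 x : x0 - r / 2 <= x -> x <= x0 + r / 2 -> ball x0 r x.
  by move=> *; rewrite /ball/= ltr_norml; apply/andP; split; lra.
have [? _] := near_x0 _ (ball_x0 (x0 - r / 2) ltac:(lra) ltac:(lra)).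
have [_ [? _]] := near_x0 _ (ball_x0 (x0 + r / 2) ltac:(lra) ltac:(lra)).
split; [lra..|].
move=> x /=; rewrite in_itv/= => /andP[x1 x2].
have [ux [xv fxm]] := near_x0 _ (ball_x0 x x1 x2).
exists n; first exact: leq_maxl.
apply: approx_quotient_ge; first lra.
apply: le_trans (dist_nearest_int_le _ m) _.
apply: le_trans (ltW fxm) _.
by rewrite lef_pV2 ?posrE ?exprn_gt0 ?lerXn2r ?nnegrE//; lra.
Unshelve. all: by end_near.
Qed.

Theorem theorem3p11 (R : realType) (alpha : R) (halpha : alpha != 0) :
  (forall a b : R, 1 <= a -> a < b ->
     Theta_infty alpha `&` `]a, b[ #= [set: R]) /\
  `]1, +oo[ `<=` closure (Theta_infty alpha).
Proof.
have cardTheta (a b : R) : 1 <= a -> a < b ->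
    Theta_infty alpha `&` `]a, b[ #= [set: R].
  move=> a1 ab; rewrite card_eq_le subset_card_le//=.
  apply: card_le_trans (card_le_real_bool_seq R) _.
  have := injfun_thick_bigcap a b _ ab
    (fun k => thick_good_approx alpha a b k halpha a1).
  move=> /card_le_trans; apply; apply: subset_card_le => x [xab levelx].
  split=> //; split; last by apply: sigma_bar_pinfty => k; exact: levelx.
  by move: xab; rewrite /= in_itv/= => /andP[? _]; lra.
split=> // x; rewrite /= in_itv/= andbT => x1 B /nbhs_ballP[r /= r0 rB].
have xr : x < x + r by lra.
have /set0P[y [Ty /=]] : Theta_infty alpha `&` `]x, x + r[ != set0.
  apply/eqP => T0; have := cardTheta _ _ (ltW x1) xr.
  rewrite T0 card_eq_sym card_eq0 => /eqP R0.
  by have : [set: R] 0 by []; rewrite R0.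
rewrite in_itv/= => /andP[xy yr]; exists y; split=> //; apply: rB.
by rewrite /ball/= ltr_norml; apply/andP; split; lra.
Qed.
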